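(* Let $M_1,\ldots,M_s$ be $m\times m$ positive semidefinite matrices. (i) For every $p\in(0,1]$, the set function $I\mapsto \operatorname{trace}\big(\sum_{i\in I}M_i\big)^p$, $I\subseteq[s]$, is submodular. (ii) The set function $I\mapsto \operatorname{rank}\big(\sum_{i\in I}M_i\big)$, $I\subseteq[s]$, is submodular. If moreover every $M_i$ is positive definite, then: (iii) The set function $I\mapsto \log\det\big(\sum_{i\in I}M_i\big)$, $I\subseteq[s]$, is submodular.
   Context: $[s]:=\{1,\ldots,s\}$; the empty sum is the zero matrix. Positive semidefinite matrices here are real symmetric. A set function $F$ on subsets of $E$ is submodular if $F(I)+F(J)\ge F(I\cup J)+F(I\cap J)$ for all $I,J\subseteq E$. For a positive semidefinite matrix $M$ with eigenvalues $\lambda_1,\ldots,\lambda_m$ (with multiplicities) and $p>0$, $\operatorname{trace} M^p=\sum_{k=1}^m\lambda_k^p$. In (iii), $\log\det$ of the zero matrix (the case $I=\emptyset$) is $-\infty$, and the submodularity inequality is understood in $\mathbb{R}\cup\{-\infty\}$. *)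

(* Defs.v *)
From mathcomp Require Import all_boot all_order all_algebra.
From mathcomp Require Import all_classical all_reals all_analysis.

Set Implicit Arguments.
Unset Strict Implicit.
Unset Printing Implicit Defensive.

Import Order.TTheory GRing.Theory Num.Theory.

Local Open Scope ring_scope.

Definition posdefmx (R : realType) (m : nat) (M : 'M[R]_m) : Prop :=
  M^T = M /\ forall v : 'cV[R]_m, v != 0 -> 0 < (v^T *m M *m v) 0 0.

Definition possemidefmx (R : realType) (m : nat) (M : 'M[R]_m) : Prop :=
  M^T = M /\ forall v : 'cV[R]_m, 0 <= (v^T *m M *m v) 0 0.

(* trace M^p, as the sum of the p-th powers of the eigenvalues of M, each
   counted with its multiplicity as a root of the characteristic polynomial.
   It is meant for p > 0 and M positive semidefinite: all complex eigenvalues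
   are then real, and 0 `^ p = 0. *)
Definition trace_powR (R : realType) (m : nat) (M : 'M[R]_m) (p : R) : R :=
  \sum_(x \in [set x : R | eigenvalue M x]%classic)
    (mup x (char_poly M))%:R * (x `^ p).

(* Both the value and the inequality live in the extended reals, so that -oo is
   an admissible value of F. No F considered here takes the value +oo, so the
   convention -oo + +oo = -oo plays no role. *)
Definition submodular (R : realType) (E : finType) (F : {set E} -> \bar R) :
    Prop :=
  forall I J : {set E}, (F (I :|: J) + F (I :&: J) <= F I + F J)%E.

(* Whenever s lists the eigenvalues with multiplicities, trace_powR is the sum
   of their p-th powers. *)
Lemma trace_powRE (R : realType) (m : nat) (M : 'M[R]_m) (p : R) (s : seq R) :
  char_poly M = \prod_(x <- s) ('X - x%:P) ->
  trace_powR M p = \sum_(x <- s) x `^ p.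
Proof.
move=> Ms; rewrite /trace_powR.
have mupE (t : seq R) x :
    mup x (\prod_(y <- t) ('X - y%:P)) = count_mem x t.
  elim: t => [|y t IH] /=; first by rewrite big_nil mupNroot// root1.
  rewrite big_cons mupM ?polyXsubC_eq0 ?monic_neq0 ?monic_prod_XsubC//.
  by rewrite IH -['X - _]expr1 mup_XsubCX; case: eqVneq.
have -> : [set x : R | eigenvalue M x]%classic = [set` undup s]%classic.
  apply/seteqP; split => x /=;
    by rewrite eigenvalue_root_char Ms root_prod_XsubC mem_undup.
rewrite -fsbig_seq ?undup_uniq// -[RHS]big_undup_iterop_count/=.
by apply: eq_bigr => x _; rewrite Ms mupE mulr_natl.
Qed.

(* Main.v *)
Require Import Defs.
From mathcomp Require Import all_boot all_order all_algebra.
From mathcomp Require Import all_classical all_reals all_analysis.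
From mathcomp Require Import measurable_realfun complex ring lra.

(* With A, B, C the sums over I :&: J, I :\: J and J :\: I, each part compares
   A + B + C and A with A + B and A + C. The matrix determinant lemma, applied
   to B rank one at a time, reduces (iii) to the antitonicity of the inverse.
   For 0 < p < 1, int ln (1 + x t) t^(-p-1) dt over t > 0 is a positive constant
   times x^p, so (i) follows by integrating (iii) for 1 + t A, t B, t C. For
   (ii), the row space of a sum of positive semidefinite matrices is the sum of
   the row spaces, so rank is submodular by the dimension formula. *)

Set Implicit Arguments.
Unset Strict Implicit.
Unset Printing Implicit Defensive.

Import Order.TTheory GRing.Theory Num.Theory.
Import numFieldNormedType.Exports.

Local Open Scope ring_scope.

(** * Closure properties of semidefinite and definite matrices *)

Lemma mx11_tr (R : Type) (A : 'M[R]_1) : A^T = A.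
Proof. by apply/matrixP => i j; rewrite mxE !ord1. Qed.

Lemma possemidefmx0 (R : realType) (m : nat) : possemidefmx (0 : 'M[R]_m).
Proof. by split=> [|v]; rewrite ?trmx0// mulmx0 mul0mx mxE. Qed.

Lemma possemidefmxD (R : realType) (m : nat) (A B : 'M[R]_m) :
  possemidefmx A -> possemidefmx B -> possemidefmx (A + B).
Proof.
move=> [As A0] [Bs B0]; split=> [|v]; first by rewrite linearD /= As Bs.
by rewrite mulmxDr mulmxDl mxE addr_ge0.
Qed.

Lemma possemidefmx_sum (R : realType) (m : nat) (I : finType) (P : {set I})
    (M : I -> 'M[R]_m) :
  (forall i, possemidefmx (M i)) -> possemidefmx (\sum_(i in P) M i).
Proof.
move=> hM; apply: big_ind => //; first exact: possemidefmx0.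
exact: possemidefmxD.
Qed.

Lemma possemidefmxZ (R : realType) (m : nat) (t : R) (A : 'M[R]_m) :
  0 <= t -> possemidefmx A -> possemidefmx (t *: A).
Proof.
move=> t0 [As A0]; split=> [|v]; first by rewrite linearZ /= As.
by rewrite -scalemxAr -scalemxAl mxE mulr_ge0.
Qed.

Lemma posdefmxW (R : realType) (m : nat) (A : 'M[R]_m) :
  posdefmx A -> possemidefmx A.
Proof.
move=> [As A0]; split=> // v; have [->|/A0/ltW//] := eqVneq v 0.
by rewrite mulmx0 mxE.
Qed.

Lemma posdefmxD (R : realType) (m : nat) (A B : 'M[R]_m) :
  posdefmx A -> possemidefmx B -> posdefmx (A + B).
Proof.
move=> [As A0] [Bs B0]; split=> [|v v0]; first by rewrite linearD /= As Bs.
by rewrite mulmxDr mulmxDl mxE ltr_wpDr// A0.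
Qed.

Lemma trmulmx_sum_sqr (R : comNzRingType) (m : nat) (v : 'cV[R]_m) :
  (v^T *m v) 0 0 = \sum_i v i 0 ^+ 2.
Proof. by rewrite mxE; apply: eq_bigr => i _; rewrite mxE expr2. Qed.

Lemma trmulmx_ge0 (R : realDomainType) (m : nat) (v : 'cV[R]_m) :
  0 <= (v^T *m v) 0 0.
Proof. by rewrite trmulmx_sum_sqr sumr_ge0// => i _; rewrite sqr_ge0. Qed.

Lemma trmulmx_eq0 (R : realDomainType) (m : nat) (v : 'cV[R]_m) :
  ((v^T *m v) 0 0 == 0) = (v == 0).
Proof.
apply/eqP/eqP => [|->]; last by rewrite mulmx0 mxE.
rewrite trmulmx_sum_sqr => /psumr_eq0P-/(_ (fun i _ => sqr_ge0 _)) v0.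
by apply/colP => i; have /eqP := v0 i isT; rewrite sqrf_eq0 mxE => /eqP.
Qed.

Lemma posdefmx1 (R : realType) (m : nat) : posdefmx (1%:M : 'M[R]_m).
Proof.
split=> [|v v0]; first by rewrite trmx1.
by rewrite mulmx1 lt_def trmulmx_eq0 v0 trmulmx_ge0.
Qed.

(** * Quadratic forms and rank-one decomposition *)

Lemma symm_formC (R : comNzRingType) (m : nat) (A : 'M[R]_m) (v w : 'cV[R]_m) :
  A^T = A -> (v^T *m A *m w) 0 0 = (w^T *m A *m v) 0 0.
Proof.
by move=> As; rewrite -[v^T *m A *m w]mx11_tr !trmx_mul trmxK As mulmxA.
Qed.

Lemma symm_formDZ (R : comNzRingType) (m : nat) (A : 'M[R]_m) (v w : 'cV[R]_m)
    (t : R) : A^T = A ->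
  ((v + t *: w)^T *m A *m (v + t *: w)) 0 0 =
  (v^T *m A *m v) 0 0 + 2 * t * (v^T *m A *m w) 0 0
    + t ^+ 2 * (w^T *m A *m w) 0 0.
Proof.
move=> As; rewrite [_^T]linearD /= [(t *: w)^T]linearZ /= !mulmxDl !mulmxDr.
rewrite -!scalemxAr -!scalemxAl.
have := symm_formC w v As.
move: (v^T *m A *m v) (v^T *m A *m w) (w^T *m A *m v) (w^T *m A *m w).
by move=> a b c d bc; rewrite !mxE bc; ring.
Qed.

(** If [w = A v] were nonzero, the form at [w + t v] would be affine in [t] with slope [2 |w|^2],
    hence negative for some [t]. *)
Lemma possemidefmx_form_eq0 (R : realType) (m : nat) (A : 'M[R]_m)
    (v : 'cV[R]_m) :
  possemidefmx A -> (v^T *m A *m v) 0 0 = 0 -> A *m v = 0.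
Proof.
move=> [As A0] v0; apply/eqP; rewrite -trmulmx_eq0 trmx_mul As.
set w := A *m v; set n := _ 0 0; set q := (w^T *m A *m w) 0 0.
apply: contraT => n0.
(* This [t] makes the form equal to [-1]. *)
have /= := A0 (w + (- (q + 1) / (2 * n)) *: v).
rewrite symm_formDZ// v0 mulr0 addr0 (symm_formC _ v As) -/q.
rewrite -[(v^T *m A *m w) 0 0]/n.
suff -> : q + 2 * (- (q + 1) / (2 * n)) * n = -1 by rewrite oppr_ge0 ler10.
by field.
Qed.

(** Otherwise the form vanishes at each basis vector, and [possemidefmx_form_eq0] kills each column
    of [A]. *)
Lemma possemidefmx_neq0_form_gt0 (R : realType) (m : nat) (A : 'M[R]_m) :
  possemidefmx A -> A != 0 -> exists v : 'cV_m, 0 < (v^T *m A *m v) 0 0.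
Proof.
move=> hA A0; apply/not_existsP => nv; case/eqP: A0.
apply/trmx_inj/row_matrixP => i; rewrite -tr_col colE trmx0 row0.
rewrite (possemidefmx_form_eq0 (v := delta_mx i 0) hA) ?trmx0//.
apply/eqP; rewrite eq_le hA.2 andbT leNgt; apply/negP; exact: nv.
Qed.

(* A - (Av)(Av)^T / (v^T A v) is again positive semidefinite, and has smaller
   rank since v is a new kernel vector. *)
Lemma possemidefmx_ind (R : realType) (m : nat) (P : 'M[R]_m -> Prop) :
  P 0 ->
  (forall A (v : 'cV_m), possemidefmx A -> P A -> P (A + v *m v^T)) ->
  forall A, possemidefmx A -> P A.
Proof.
move=> P0 PD A; have [n] := ubnP (\rank A).
elim: n A => // n IH A rA hA; have [->//|A0] := eqVneq A 0.
have [v] := possemidefmx_neq0_form_gt0 hA A0; set c := _ 0 0 => c0.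
pose d := Num.sqrt c; pose u := d^-1 *: (A *m v).
have dd : d ^+ 2 = c by rewrite sqr_sqrtr// ltW.
have uuE : u *m u^T = c^-1 *: (A *m v *m v^T *m A).
  rewrite /u linearZ /= -scalemxAl -scalemxAr scalerA -invfM -expr2 dd.
  by rewrite trmx_mul hA.1 !mulmxA.
pose B := A - u *m u^T.
have vAv : v^T *m A *m v = c%:M by rewrite [LHS]mx11_scalar.
have Bv : B *m v = 0.
  rewrite mulmxBl uuE -scalemxAl -!mulmxA (mulmxA _ A v) vAv.
  rewrite mul_mx_scalar -scalemxAr scalerA mulVf ?gt_eqF//.
  by rewrite scale1r subrr.
have hB : possemidefmx B.
  split; first by rewrite linearB /= trmx_mul trmxK hA.1.
  move=> w; set a := (w^T *m A *m v) 0 0.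
  (* The value [- a / c] minimises the form of [A] at [w + t v] over [t], and the minimum is the
     form of [B] at [w]. *)
  have : 0 <= ((w + (- a / c) *: v)^T *m A *m (w + (- a / c) *: v)) 0 0.
    exact: hA.2.
  rewrite symm_formDZ ?hA.1// -/a -/c => /le_trans; apply.
  have mxBZ (X Y : 'M[R]_1) t : (X - t *: Y) 0 0 = X 0 0 - t * Y 0 0.
    by rewrite !mxE.
  rewrite mulmxBr mulmxBl uuE -scalemxAr -scalemxAl mxBZ.
  have -> : (w^T *m (A *m v *m v^T *m A) *m w) 0 0 = a * a.
    rewrite !mulmxA -(mulmxA _ A w) -(mulmxA _ v^T).
    rewrite [w^T *m A *m v]mx11_scalar mul_scalar_mx mxE mulmxA.
    by rewrite (symm_formC v w hA.1).
  by rewrite le_eqVlt -/c; apply/orP; left; apply/eqP; field; rewrite gt_eqF.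
rewrite -(subrK (u *m u^T) A) -/B; apply: PD => //; apply: IH => //.
rewrite ltnS in rA; apply: leq_trans rA.
(* The inclusion of row spaces is strict: [A = X B] would give [v^T A v = v^T X B v = 0], against
   [c > 0]. *)
have BA : (B <= A)%MS.
  apply/submxP; exists (1%:M - c^-1 *: (A *m v *m v^T)).
  by rewrite mulmxBl mul1mx -scalemxAl -uuE.
suff : (B < A)%MS by rewrite ltmxErank => /andP[].
rewrite ltmxE BA; apply/negP => /submxP[X AX].
by move: c0; rewrite /c -mulmxA AX -mulmxA Bv !mulmx0 mxE ltxx.
Qed.

(** * Rank-one updates of determinants, and inverses *)

(** Both sides are the determinant of the block matrix [M], read off after a block elimination of
    its lower left or of its upper right corner. *)
Lemma det_addmx_mul (R : comNzRingType) (m : nat) (u : 'cV[R]_m)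
    (w : 'rV[R]_m) :
  \det (1%:M + u *m w) = 1 + (w *m u) 0 0.
Proof.
pose M : 'M[R]_(1 + m) := block_mx 1%:M (- w) u 1%:M.
have M1 : block_mx 1%:M 0 (- u) 1%:M *m M =
    block_mx 1%:M (- w) 0 (1%:M + u *m w).
  by rewrite /M mulmx_block !(mul1mx, mulmx1, mul0mx, mulmx0, addr0, addNr)
    mulNmx mulmxN opprK addrC.
have M2 : block_mx 1%:M w 0 1%:M *m M = block_mx (1%:M + w *m u) 0 u 1%:M.
  by rewrite /M mulmx_block !(mul1mx, mulmx1, mul0mx, mulmx0, add0r, addNr).
have := congr1 determinant M2.
rewrite det_mulmx det_ublock !det1 !mul1r det_lblock det1 mulr1 det_mx11.
have := congr1 determinant M1.
rewrite det_mulmx det_lblock !det1 !mul1r det_ublock det1 mul1r => <- ->.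
by rewrite [LHS]mxE [in LHS]mxE eqxx.
Qed.

Lemma det_addmx_mul_tr (R : comUnitRingType) (m : nat) (X : 'M[R]_m)
    (v : 'cV[R]_m) :
  X \in unitmx ->
  \det (X + v *m v^T) = \det X * (1 + (v^T *m invmx X *m v) 0 0).
Proof.
move=> Xu; rewrite -mulmxA -det_addmx_mul -det_mulmx.
by rewrite mulmxDr mulmx1 !mulmxA mulmxV// mul1mx.
Qed.

Lemma posdefmx_unit (R : realType) (m : nat) (A : 'M[R]_m) :
  posdefmx A -> A \in unitmx.
Proof.
move=> [As A0]; rewrite -row_free_unit -kermx_eq0; apply/eqP/row_matrixP => i.
rewrite row0; apply/eqP; apply: contraT => v0.
have /A0 : (row i (kermx A))^T != 0 by rewrite -trmx0 (inj_eq trmx_inj).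
by rewrite trmxK -row_mul mulmx_ker row0 mul0mx mxE ltxx.
Qed.

(* Put u = (A + C)^-1 v and w = A^-1 v; then the claim follows from
   (w - u)^T A (w - u) >= 0 and u^T C u >= 0. *)
Lemma posdefmx_inv_anti (R : realType) (m : nat) (A C : 'M[R]_m)
    (v : 'cV[R]_m) : posdefmx A -> possemidefmx C ->
  (v^T *m invmx (A + C) *m v) 0 0 <= (v^T *m invmx A *m v) 0 0.
Proof.
move=> hA hC; have hD := posdefmxD hA hC.
have Au := posdefmx_unit hA; have Du := posdefmx_unit hD.
set u := invmx (A + C) *m v; set w := invmx A *m v.
have vD : (A + C) *m u = v by rewrite mulmxA mulmxV// mul1mx.
have vA : A *m w = v by rewrite mulmxA mulmxV// mul1mx.
rewrite -!mulmxA -/u -/w.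
have -> : (v^T *m w) 0 0 = (w^T *m A *m w) 0 0 by rewrite -{1}vA trmx_mul hA.1.
have E1 : (v^T *m u) 0 0 = (w^T *m A *m u) 0 0 by rewrite -{1}vA trmx_mul hA.1.
have : (v^T *m u) 0 0 = (u^T *m A *m u) 0 0 + (u^T *m C *m u) 0 0.
  by rewrite -{1}vD trmx_mul hD.1 mulmxDr mulmxDl mxE.
have := (posdefmxW hA).2 (w + (-1) *: u); have := hC.2 u.
rewrite symm_formDZ ?hA.1// -E1; lra.
Qed.

(** * Characteristic polynomials and spectra *)

Lemma char_poly_horner (R : comNzRingType) (m : nat) (A : 'M[R]_m) (x : R) :
  (char_poly A).[x] = \det (x%:M - A).
Proof.
rewrite /char_poly -horner_evalE -det_map_mx; congr (\det _).
apply/matrixP => i j.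
by rewrite !mxE /= /horner_eval !hornerE hornerMn hornerX.
Qed.

Lemma char_poly_conj (F : fieldType) (m : nat) (P D : 'M[F]_m) :
  P \in unitmx -> char_poly (invmx P *m D *m P) = char_poly D.
Proof.
move=> Pu; rewrite /char_poly /char_poly_mx.
have PP : map_mx polyC (invmx P) *m map_mx polyC P = 1%:M.
  by rewrite -map_mxM mulVmx// map_mx1.
have XE : 'X%:M = map_mx polyC (invmx P) *m 'X%:M *m map_mx polyC P.
  by rewrite scalar_mxC -mulmxA PP mulmx1.
rewrite !map_mxM [in LHS]XE -mulmxBl -mulmxBr !det_mulmx mulrAC -det_mulmx.
by rewrite PP det1 mul1r.
Qed.

(** Over [complex R] the matrix is Hermitian, so the spectral theorem diagonalises it with real
    diagonal entries. The factorisation descends to [R] because the embedding of polynomials is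
    injective. *)
Lemma symm_char_poly_split (R : realType) (m : nat) (A : 'M[R]_m) :
  A^T = A -> exists s : seq R, char_poly A = \prod_(x <- s) ('X - x%:P).
Proof.
move=> As; pose f : {rmorphism R -> complex R} := real_complex R.
pose B := map_mx f A.
have BH : B \is hermsymmx.
  apply: realsym_hermsym.
    by apply/is_hermitianmxP; rewrite expr0 scale1r map_mx_id// map_trmx As.
  by apply/mxOverP => i j; rewrite mxE; apply/complex_realP; exists (A i j).
have /orthomx_spectralP BE := hermitian_normalmx BH.
have /mxOverP rD := hermitian_spectral_diag_real BH.
exists [seq complex.Re (spectral_diag B 0 i) | i <- enum 'I_m].
apply: (map_poly_inj f); rewrite map_char_poly -/B [in LHS]BE.
rewrite char_poly_conj ?spectral_unit//.
rewrite char_poly_trig ?diag_mx_is_trig// rmorph_prod big_map big_enum /=.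
apply: eq_bigr => i _; rewrite map_polyXsubC /= RRe_real//.
by rewrite mxE eqxx mulr1n.
Qed.

Lemma possemidefmx_spectrum (R : realType) (m : nat) (A : 'M[R]_m) :
  possemidefmx A ->
  exists s : seq R, [/\ char_poly A = \prod_(x <- s) ('X - x%:P),
    size s = m & forall x, x \in s -> 0 <= x].
Proof.
move=> hA; have [s sE] := symm_char_poly_split hA.1.
exists s; split=> // [|x xs].
  by have := size_char_poly A; rewrite sE size_prod_XsubC => -[].
have /eigenvalueP[v vA v0] : eigenvalue A x.
  by rewrite eigenvalue_root_char sE root_prod_XsubC.
(* The form at the eigenvector is [x |v|^2], with [|v|^2 > 0]. *)
have := hA.2 v^T; rewrite trmxK vA -scalemxAl mxE.
have := trmulmx_ge0 v^T; rewrite trmxK le_eqVlt => /predU1P[/esym/eqP|].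
  rewrite -[X in (X *m _) _ _]trmxK trmulmx_eq0.
  by rewrite -trmx0 (inj_eq trmx_inj) (negPf v0).
by move=> ?; rewrite pmulr_lge0.
Qed.

(** For nonzero [t] the determinant is [(-t)^m] times the characteristic polynomial of [A] at
    [- 1 / t]; the [m] factors [- t] are spread over the [m] roots. *)
Lemma det1DZ_split (R : fieldType) (m : nat) (A : 'M[R]_m) (s : seq R) (t : R) :
  char_poly A = \prod_(x <- s) ('X - x%:P) ->
  \det (1%:M + t *: A) = \prod_(x <- s) (1 + t * x).
Proof.
move=> sE; have ss : size s = m.
  by have := size_char_poly A; rewrite sE size_prod_XsubC => -[].
have [->|t0] := eqVneq t 0.
  by rewrite scale0r addr0 det1 big1// => x _; rewrite mul0r addr0.
have -> : 1%:M + t *: A = (- t) *: ((- t^-1)%:M - A).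
  by rewrite scalerBr scale_scalar_mx mulrNN divff// scaleNr opprK.
rewrite detZ -char_poly_horner sE horner_prod -ss.
have -> (r : seq R) F :
    (- t) ^+ size r * \prod_(x <- r) F x = \prod_(x <- r) (- t * F x).
  elim: r => [|x r IH]; rewrite ?big_nil ?mulr1// !big_cons -IH exprS.
  by rewrite mulrACA.
by apply: eq_bigr => x _; rewrite !hornerE mulrBr mulrNN divff// mulNr opprK.
Qed.

(** The determinant is a product of nonnegative eigenvalues, and is nonzero by invertibility. *)
Lemma posdefmx_det_gt0 (R : realType) (m : nat) (A : 'M[R]_m) :
  posdefmx A -> 0 < \det A.
Proof.
move=> hA; have [s [sE ss s0]] := possemidefmx_spectrum (posdefmxW hA).
rewrite lt_def -unitfE -unitmxE posdefmx_unit//=.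
have := char_poly_det A; rewrite sE coef0_prod_XsubC ss => /eqP.
rewrite (inj_eq (mulfI _)) ?signr_eq0// => /eqP <-.
by rewrite big_seq prodr_ge0.
Qed.

(** * Determinant and rank inequalities *)

(** Adding [v v^T] to [B] multiplies the left side by [1 + v^T (A + B + C)^-1 v] and the right side
    by [1 + v^T (A + B)^-1 v]. Only [A] is taken definite, so that (i) can use it for [1 + t A],
    [t B], [t C]. *)
Lemma det_submodular (R : realType) (m : nat) (A B C : 'M[R]_m) :
  posdefmx A -> possemidefmx B -> possemidefmx C ->
  \det (A + B + C) * \det A <= \det (A + B) * \det (A + C).
Proof.
move=> hA hB hC; elim/possemidefmx_ind: B / hB => [|B v hB IH].
  by rewrite addr0 mulrC.
have hAB := posdefmxD hA hB; have hABC := posdefmxD hAB hC.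
rewrite addrA (addrAC _ (v *m v^T)) !det_addmx_mul_tr ?posdefmx_unit//.
rewrite mulrAC [leRHS]mulrAC; apply: ler_pM => //.
- by rewrite mulr_ge0// ltW// posdefmx_det_gt0.
(* With [X = A + B + C], [v^T X^-1 v] is the form of [X] at [X^-1 v]. *)
- have := (posdefmxW hABC).2 (invmx (A + B + C) *m v).
  rewrite trmx_mul trmx_inv hABC.1 -!mulmxA mulKVmx ?posdefmx_unit// => ?.
  by rewrite addr_ge0.
- by rewrite lerD2l posdefmx_inv_anti.
Qed.

(** Dually, the kernel of [A + B] lies in that of [A]: if [(A + B) v = 0], the two nonnegative forms
    at [v] sum to zero, so both vanish. *)
Lemma possemidefmx_submxD (R : realType) (m : nat) (A B : 'M[R]_m) :
  possemidefmx A -> possemidefmx B -> (A <= (A + B)%R)%MS.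
Proof.
move=> hA hB; rewrite submxE; apply/eqP/trmx_inj/row_matrixP => i.
rewrite -tr_col trmx0 row0 colE -mulmxA; set v := _ *m delta_mx _ _.
suff -> : A *m v = 0 by rewrite trmx0.
apply: possemidefmx_form_eq0 => //.
have : (A + B) *m v = 0 by rewrite mulmxA mulmx_coker mul0mx.
move=> /(congr1 (fun X => (v^T *m X) 0 0)); rewrite mulmx0 mulmxA mulmxDr.
rewrite mulmxDl [LHS]mxE [RHS]mxE => /eqP.
by rewrite paddr_eq0 ?hA.2 ?hB.2// => /andP[/eqP].
Qed.

(** The dimension formula is applied to the row spaces of [A + B] and [A + C]: their sum contains
    that of [A + B + C], their intersection that of [A]. *)
Lemma mxrank_submodular (R : realType) (m : nat) (A B C : 'M[R]_m) :
  possemidefmx A -> possemidefmx B -> possemidefmx C ->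
  (\rank (A + B + C)%R + \rank A <= \rank (A + B)%R + \rank (A + C)%R)%N.
Proof.
move=> hA hB hC; rewrite -[leqRHS]mxrank_sum_cap leq_add ?mxrankS//.
  have -> : A + B + C = (A + B) + ((A + C) - A) by rewrite (addrC A C) addrK.
  rewrite addmx_sub ?addsmxSl// addmx_sub ?addsmxSr// eqmx_opp.
  by apply: submx_trans (addsmxSl _ _); exact: possemidefmx_submxD.
by rewrite sub_capmx !possemidefmx_submxD.
Qed.

(** * The integral representing powers *)

(** This is [ln (1 + t) t^(-p-1) dt] after [t = e^y], which turns scaling of [t] into translation of
    [y]. *)
Definition logkernel (R : realType) (p y : R) : R :=
  ln (1 + expR y) * expR (- (p * y)).

Lemma ln1DexpR_gt0 (R : realType) (y : R) : 0 < ln (1 + expR y).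
Proof. by rewrite ln_gt0// ltrDl expR_gt0. Qed.

Lemma logkernel_gt0 (R : realType) (p y : R) : 0 < logkernel p y.
Proof. by rewrite mulr_gt0 ?expR_gt0 ?ln1DexpR_gt0. Qed.

Lemma continuous_expRNZ (R : realType) (c : R) :
  continuous (fun x => expR (- (c * x))).
Proof.
move=> x; apply: (@continuous_comp _ _ _ (fun z => - (c * z)) expR).
  apply: (@continuousN _ R^o); apply: (@continuousM _ R^o) => //.
  exact: cst_continuous.
exact: continuous_expR.
Qed.

Lemma continuous_logkernel (R : realType) (p : R) : continuous (logkernel p).
Proof.
move=> y; apply: (@continuousM _ R^o (fun z => ln (1 + expR z))
  (fun z => expR (- (p * z)))).
  apply: (@continuous_comp _ _ _ (fun z => 1 + expR z) (@ln R)).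
    apply: (@continuousD _ R^o); first exact: cst_continuous.
    exact: continuous_expR.
  by apply: continuous_ln; rewrite addr_gt0 ?expR_gt0.
exact: continuous_expRNZ.
Qed.

Lemma continuous_integral_shift (R : realType) (f : R -> R) (s : R) :
  (forall x, 0 <= f x) -> continuous f ->
  (\int[lebesgue_measure]_x (f (x + s))%:E =
   \int[lebesgue_measure]_x (f x)%:E)%E.
Proof.
move=> f0 cf.
have dE : ((shift s : R -> R)^`() = cst 1)%classic.
  apply/funext => x; rewrite derive1E.
  exact: (@derive_val _ _ _ _ _ _ _ (is_derive_shift x 1 s)).
rewrite [RHS](increasing_ge0_integration_by_substitutionT (F := shift s))//
  ?dE//.
- by apply: eq_integral => x _ /=; rewrite mulr1.
- by move=> x y xy /=; rewrite ltrD2r.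
- by move=> x; exact: cvg_cst.
- exact: is_cvg_cst.
- exact: is_cvg_cst.
- exact: cvg_addrr_Ny.
- exact: cvg_addrr.
Qed.

(** On the half-line, [c] times the integrand is the exponential density, whose integral is 1. *)
Lemma integral_expRNZ_lty (R : realType) (c : R) : 0 < c ->
  (\int[lebesgue_measure]_(x in [set x | (0 <= x)%R]%classic)
     (expR (- (c * x)))%:E < +oo)%E.
Proof.
move=> c0.
have := integral_exponential_pdf c0.
have -> : (fun x => (exponential_pdf c x)%:E)
    = ((fun x : R => (c%:E * (expR (- (c * x)))%:E)%E) \_ `[0, +oo[%classic).
  apply/funext => x; rewrite /exponential_pdf !patchE; case: ifP => // _.
  by rewrite -EFinM mulNr.
rewrite -integral_mkcond set_itvcy ge0_integralZl_EFin ?ltW//; last 2 first.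
- by rewrite -set_itvcy.
- apply/measurable_EFinP; apply: measurable_funTS.
  by apply: continuous_measurable_fun; exact: continuous_expRNZ.
rewrite ltNge leye_eq => int1; apply/negP => /eqP inty; move: int1.
by rewrite inty gt0_muley ?lte_fin.
Qed.

(** For [y >= 0], [ln (1 + e^y) <= 1 + y <= (2 / p) e^(p y / 2)] leaves the decay [e^(- p y / 2)].
    For [y < 0], [ln (1 + e^y) <= e^y] leaves [e^((1 - p) y)]. The minimum of the two rates serves
    both sides. *)
Lemma logkernel_le (R : realType) (p y : R) : 0 < p -> p < 1 ->
  logkernel p y <= 2 / p * expR (- (Num.min (p / 2) (1 - p) * `|y|)).
Proof.
move=> p0 p1; set c := Num.min _ _.
have c1 : c <= p / 2 by rewrite ge_min lexx.
have c2 : c <= 1 - p by rewrite ge_min lexx orbT.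
have [y0|y0] := leP 0 y.
  have ln_le : ln (1 + expR y) <= 2 / p * expR (p / 2 * y).
    have : ln (1 + expR y) <= 1 + y.
      rewrite -[leRHS]expRK ler_ln ?posrE ?expR_gt0 ?addr_gt0 ?expR_gt0//.
      have e0 : 1 <= expR y by rewrite -expR0 ler_expR.
      (* [1 + e^y <= 2 e^y <= e e^y], the last since [e >= 1 + 1]. *)
      by rewrite expRD; have := expR_ge1Dx (1 : R); nra.
    move=> /le_trans; apply; rewrite -ler_pdivrMl ?divr_gt0// invf_div.
    by apply: le_trans (expR_ge1Dx _); nra.
  apply: le_trans (ler_wpM2r (expR_ge0 _) ln_le) _.
  rewrite -(mulrA (2 / p)) ler_wpM2l ?divr_ge0 ?(ltW p0)// -expRD ler_expR.
  by rewrite ger0_norm//; nra.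
apply: (@le_trans _ _ (1 * expR (- (c * `|y|)))); last first.
  by rewrite ler_wpM2r ?expR_ge0// ler_pdivlMr// mul1r; lra.
rewrite mul1r; apply: (@le_trans _ _ (expR y * expR (- (p * y)))).
  rewrite ler_wpM2r ?expR_ge0//; apply: le_trans (le_ln1Dx _) _ => //.
  by rewrite (lt_trans _ (expR_gt0 _))// ltrN10.
rewrite -expRD ler_expR ltr0_norm//; nra.
Qed.

Lemma measurable_logkernel (R : realType) (p : R) (D : set R) :
  measurable_fun D (logkernel p).
Proof.
apply: measurable_funTS; apply: continuous_measurable_fun.
exact: continuous_logkernel.
Qed.

Lemma integral_logkernel_lty (R : realType) (p : R) : 0 < p -> p < 1 ->
  (\int[lebesgue_measure]_y (logkernel p y)%:E < +oo)%E.
Proof.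
move=> p0 p1; set c := Num.min (p / 2) (1 - p).
have c0 : 0 < c by rewrite lt_min divr_gt0// subr_gt0.
pose g (y : R) := 2 / p * expR (- (c * `|y|)).
have cg : continuous g.
  move=> y; apply: (@continuousM _ R^o (cst (2 / p))
    (fun z => expR (- (c * `|z|)))).
    exact: cst_continuous.
  apply: (@continuous_comp _ _ _ (fun z : R => `|z|)
    (fun z => expR (- (c * z)))).
    exact: norm_continuous.
  exact: continuous_expRNZ.
have g0 y : 0 <= g y by rewrite mulr_ge0 ?expR_ge0 ?divr_ge0 ?ltW.
apply: (@le_lt_trans _ _ (\int[lebesgue_measure]_y (g y)%:E)%E).
  apply: ge0_le_integral => //.
  - by move=> y _; rewrite lee_fin ltW// logkernel_gt0.
  - by apply/measurable_EFinP; exact: measurable_logkernel.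
  - by apply/measurable_EFinP; exact: continuous_measurable_fun.
  - by move=> y _; rewrite lee_fin logkernel_le.
(* The dominating function is even, so its integral is twice that over the half-line. *)
rewrite ge0_symfun_integralT//; last by move=> y; rewrite /g /= normrN.
rewrite lte_mul_pinfty//.
rewrite (_ : integral _ _ _ =
  \int[lebesgue_measure]_(x in [set x | (0 <= x)%R]%classic)
    ((2 / p)%:E * (expR (- (c * x)))%:E))%E; last first.
  by apply: eq_integral => x; rewrite inE /g => x0; rewrite -EFinM ger0_norm.
have m0 : measurable [set x : R | (0 <= x)%R]%classic by rewrite -set_itvcy.
rewrite ge0_integralZl_EFin ?divr_ge0 ?ltW//.
- by rewrite lte_mul_pinfty ?lee_fin ?divr_ge0 ?ltW// integral_expRNZ_lty.
- apply/measurable_EFinP; apply: measurable_funTS.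
  by apply: continuous_measurable_fun; exact: continuous_expRNZ.
Qed.

Lemma integral_logkernel_gt0 (R : realType) (p : R) : 0 < p ->
  (0 < \int[lebesgue_measure]_y (logkernel p y)%:E)%E.
Proof.
(* On [[0, 1]] the first factor is at least its value at 0 and the second at least its value at 1;
   [m] is the product of these. *)
move=> p0; pose m := ln (1 + 1 : R) * expR (- p).
have m0 : 0 < m by rewrite mulr_gt0 ?expR_gt0// ln_gt0// ltrDl.
apply: (@lt_le_trans _ _ (\int[lebesgue_measure]_(y in `[0%R, 1%R]%classic)
    (logkernel p y)%:E)%E); last first.
  apply: ge0_subset_integral => //.
    by apply/measurable_EFinP; exact: measurable_logkernel.
  by move=> y _; rewrite lee_fin ltW// logkernel_gt0.
apply: (@lt_le_trans _ _
    (\int[lebesgue_measure]_(y in `[0%R, 1%R]%classic) (cst m%:E y))%E).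
  rewrite integral_cst//= lebesgue_measure_itv/= lte_fin ltr01 oppr0 adde0.
  by rewrite mule1 lte_fin.
apply: ge0_le_integral => //.
- by move=> y _; rewrite lee_fin ltW.
- by apply/measurable_EFinP; exact: measurable_logkernel.
move=> y /=; rewrite in_itv/= => /andP[y0 y1]; rewrite lee_fin.
apply: ler_pM; rewrite ?expR_ge0 ?ln_ge0 ?ler_expR ?lerDl//.
  by rewrite ler_ln ?posrE ?addr_gt0 ?expR_gt0// lerD2l -expR0 ler_expR.
by rewrite lerN2 ger_pMr.
Qed.

(** For [x > 0], [e^y x = e^(y + ln x)], and the shift in the exponential weight is compensated by
    [x^p]. At [x = 0] both sides vanish, whatever [ln 0] is. *)
Lemma powR_logkernel (R : realType) (p x y : R) : 0 < p -> 0 <= x ->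
  ln (1 + expR y * x) * expR (- (p * y)) = x `^ p * logkernel p (y + ln x).
Proof.
move=> p0; rewrite le_eqVlt => /predU1P[<-|x0].
  by rewrite mulr0 addr0 ln1 powR0 ?gt_eqF// !mul0r.
rewrite /logkernel expRD lnK// mulrCA; congr (_ * _).
by rewrite /powR gt_eqF// -expRD; congr expR; ring.
Qed.

Lemma measurable_logkernel_shift (R : realType) (p a s : R) :
  measurable_fun setT (fun y : R => (a * logkernel p (y + s))%:E).
Proof.
apply/measurable_EFinP; apply: measurable_funM => //.
apply: (@measurableT_comp _ _ _ _ _ _ (logkernel p)).
  exact: measurable_logkernel.
exact: measurable_funD.
Qed.

(** Translation invariance removes each shift [ln x], leaving one common integral. *)
Lemma integral_sum_logkernel (R : realType) (p : R) (s : seq R) :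
  (\int[lebesgue_measure]_y
     (\sum_(x <- s) x `^ p * logkernel p (y + ln x))%:E =
  (\sum_(x <- s) x `^ p)%:E * \int[lebesgue_measure]_y (logkernel p y)%:E)%E.
Proof.
have k0 y : 0 <= logkernel p y by exact/ltW/logkernel_gt0.
under eq_integral do rewrite -sumEFin.
rewrite ge0_integral_sum//=; last 2 first.
- by move=> x; exact: measurable_logkernel_shift.
- by move=> x y _; rewrite lee_fin mulr_ge0 ?powR_ge0.
rewrite -sumEFin ge0_sume_distrl; last first.
  by move=> x _; rewrite lee_fin powR_ge0.
apply: eq_bigr => x _; under eq_integral do rewrite EFinM.
rewrite ge0_integralZl_EFin ?powR_ge0//; last 2 first.
- by move=> y _; rewrite lee_fin.
- by under eq_fun do rewrite -[_%:E]mul1e; exact: measurable_logkernel_shift.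
by rewrite continuous_integral_shift//; exact: continuous_logkernel.
Qed.

Lemma ln_prod (R : realType) (s : seq R) : (forall x, x \in s -> 0 < x) ->
  ln (\prod_(x <- s) x) = \sum_(x <- s) ln x.
Proof.
elim: s => [|x s IH] s0; first by rewrite !big_nil ln1.
have s0' y : y \in s -> 0 < y by move=> ys; rewrite s0// inE ys orbT.
rewrite !big_cons lnM ?IH// posrE; first by rewrite s0// mem_head.
by rewrite big_seq prodr_gt0.
Qed.

(* With y = ln t, the hypothesis bounds pointwise the integrands in
   int ln (1 + x e^y) e^(- p y) dy = x^p * int ln (1 + e^y) e^(- p y) dy. *)
Lemma sum_powR_le (R : realType) (p : R) (a b : seq R) :
  0 < p -> p < 1 ->
  (forall x, x \in a -> 0 <= x) -> (forall x, x \in b -> 0 <= x) ->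
  (forall t, 0 < t ->
    \prod_(x <- a) (1 + t * x) <= \prod_(x <- b) (1 + t * x)) ->
  \sum_(x <- a) x `^ p <= \sum_(x <- b) x `^ p.
Proof.
move=> p0 p1 a0 b0 ab; pose mu := @lebesgue_measure R.
pose I := (\int[mu]_y (logkernel p y)%:E)%E.
pose K (s : seq R) y := \sum_(x <- s) x `^ p * logkernel p (y + ln x).
have K0 s y : 0 <= K s y.
  by apply: sumr_ge0 => x _; rewrite mulr_ge0 ?powR_ge0 ?ltW ?logkernel_gt0.
have mK s : measurable_fun setT (fun y : R => (K s y)%:E).
  rewrite /K; under eq_fun do rewrite -sumEFin.
  by apply: emeasurable_sum => x _; exact: measurable_logkernel_shift.
have KE s y : (forall x, x \in s -> 0 <= x) ->
    K s y = ln (\prod_(x <- s) (1 + expR y * x)) * expR (- (p * y)).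
  move=> s0; rewrite -(big_map (fun x => 1 + expR y * x) predT id) ln_prod.
    rewrite big_map mulr_suml; apply: eq_big_seq => x /s0 x0.
    by rewrite powR_logkernel.
  by move=> _ /mapP[x /s0 x0 ->]; rewrite ltr_wpDr// mulr_ge0// expR_ge0.
have prod_gt0 (s : seq R) y : (forall x, x \in s -> 0 <= x) ->
    0 < \prod_(x <- s) (1 + expR y * x).
  move=> s0; rewrite big_seq; apply: prodr_gt0 => x /s0 x0.
  by rewrite ltr_wpDr// mulr_ge0// expR_ge0.
(* The constant is finite and positive, so the goal may be multiplied by it and read as an
   inequality of integrals. *)
have IE : I = (fine I)%:E.
  rewrite fineK// ge0_fin_numE ?integral_logkernel_lty//.
  by rewrite ltW// integral_logkernel_gt0.
have I0 : 0 < fine I by rewrite -lte_fin -IE integral_logkernel_gt0.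
rewrite -(ler_pM2r I0) -lee_fin !EFinM -IE -!integral_sum_logkernel.
apply: ge0_le_integral => //.
- by move=> y _; rewrite lee_fin; exact: K0.
- exact: mK.
- exact: mK.
move=> y _; rewrite lee_fin -/(K a y) -/(K b y) !KE// ler_wpM2r ?expR_ge0//.
by rewrite ler_ln ?posrE ?prod_gt0// ab// expR_gt0.
Qed.

(** * Traces of powers and logarithms of determinants *)

(** This serves the endpoint [p = 1], where the integral of [logkernel] diverges at [-oo]. The sum
    of the roots is read off the subleading coefficient of the characteristic polynomial. *)
Lemma trace_powR1 (R : realType) (m : nat) (A : 'M[R]_m) :
  possemidefmx A -> trace_powR A 1 = \tr A.
Proof.
move=> /possemidefmx_spectrum[s [sE ss s0]]; rewrite (trace_powRE _ sE).
under eq_big_seq do rewrite powRr1 ?s0//.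
(* For [m = 0] there is no subleading coefficient; both sides are empty sums. *)
have [m0|m0] := posnP m.
  rewrite (size0nil (etrans ss m0)) big_nil /mxtrace big_pred0// => i.
  by have := leq_ltn_trans (leq0n i) (ltn_ord i); rewrite m0.
apply: oppr_inj; rewrite -char_poly_trace// sE -ss coefPn_prod_XsubC//.
by rewrite ss -lt0n.
Qed.

Lemma trace_powR_submodular (R : realType) (m : nat) (A B C : 'M[R]_m) (p : R) :
  0 < p -> p <= 1 -> possemidefmx A -> possemidefmx B -> possemidefmx C ->
  trace_powR (A + B + C) p + trace_powR A p
    <= trace_powR (A + B) p + trace_powR (A + C) p.
Proof.
move=> p0 p1 hA hB hC.
have hAB := possemidefmxD hA hB; have hAC := possemidefmxD hA hC.
have hABC := possemidefmxD hAB hC.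
move: p1; rewrite le_eqVlt => /predU1P[->|p1].
  (* At [p = 1] linearity of the trace gives equality. *)
  by rewrite !trace_powR1// !raddfD /=; lra.
have [a [aE _ a0]] := possemidefmx_spectrum hA.
have [b [bE _ b0]] := possemidefmx_spectrum hAB.
have [c [cE _ c0]] := possemidefmx_spectrum hAC.
have [d [dE _ d0]] := possemidefmx_spectrum hABC.
(* Concatenating spectra turns each side into a single power sum, and the products in [sum_powR_le]
   into products of two determinants. *)
rewrite (trace_powRE _ aE) (trace_powRE _ bE) (trace_powRE _ cE).
rewrite (trace_powRE _ dE) -!big_cat; apply: sum_powR_le => //.
- by move=> x; rewrite mem_cat => /orP[/d0|/a0].
- by move=> x; rewrite mem_cat => /orP[/b0|/c0].
move=> t t0; rewrite !big_cat /= -(det1DZ_split t aE).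
rewrite -(det1DZ_split t bE) -(det1DZ_split t cE).
rewrite -(det1DZ_split t dE) !scalerDr !addrA.
have t0' := ltW t0; apply: det_submodular; try exact: possemidefmxZ.
by apply: posdefmxD; [exact: posdefmx1|exact: possemidefmxZ].
Qed.

Lemma lne_det_submodular (R : realType) (m : nat) (A B C : 'M[R]_m) :
  posdefmx A -> possemidefmx B -> possemidefmx C ->
  (lne (\det (A + B + C))%:E + lne (\det A)%:E
    <= lne (\det (A + B))%:E + lne (\det (A + C))%:E)%E.
Proof.
move=> hA hB hC; have hAB := posdefmxD hA hB; have hAC := posdefmxD hA hC.
have hABC := posdefmxD hAB hC.
rewrite !lne_EFin ?posdefmx_det_gt0// -!EFinD lee_fin.
rewrite -!lnM ?posrE ?posdefmx_det_gt0//.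
by rewrite ler_ln ?posrE ?mulr_gt0 ?posdefmx_det_gt0// det_submodular.
Qed.

(** * Submodularity of the set functions *)

Lemma submodular_sum (R : realType) (E : finType) (V : zmodType)
    (F : V -> \bar R) (M : E -> V) :
  (forall I J : {set E},
    let A := \sum_(i in I :&: J) M i in
    let B := \sum_(i in I :\: J) M i in
    let C := \sum_(i in J :\: I) M i in
    (F (A + B + C)%R + F A <= F (A + B)%R + F (A + C)%R)%E) ->
  submodular (fun I : {set E} => F (\sum_(i in I) M i)).
Proof.
move=> FM I J; have := FM I J => /=.
have -> : \sum_(i in I :&: J) M i + \sum_(i in I :\: J) M i =
  \sum_(i in I) M i.
  by rewrite -big_setID.
have -> : \sum_(i in I :&: J) M i + \sum_(i in J :\: I) M i =
  \sum_(i in J) M i.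
  by rewrite finset.setIC -big_setID.
have -> // : \sum_(i in I) M i + \sum_(i in J :\: I) M i =
  \sum_(i in I :|: J) M i.
rewrite [RHS](big_setID I) /= finset.setUK finset.setDUl.
by rewrite finset.setDv finset.set0U.
Qed.

Theorem corollary2p5 (R : realType) (m s : nat) (M : 'I_s -> 'M[R]_m)
    (hM : forall i, possemidefmx (M i)) :
  (forall p : R, 0 < p -> p <= 1 ->
     submodular (fun I : {set 'I_s} => (trace_powR (\sum_(i in I) M i) p)%:E)) /\
  submodular (fun I : {set 'I_s} => ((\rank (\sum_(i in I) M i)%R)%:R : R)%:E) /\
  ((forall i, posdefmx (M i)) ->
     submodular (fun I : {set 'I_s} => lne (\det (\sum_(i in I) M i))%:E)).
Proof.
have hS (I : {set 'I_s}) := possemidefmx_sum I hM.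
split=> [p p0 p1|]; [|split=> [|pM]].
- apply: (submodular_sum (F := fun X : 'M[R]_m => (trace_powR X p)%:E)).
  move=> I J /=.
  by rewrite -!EFinD lee_fin trace_powR_submodular.
- apply: (submodular_sum (F := fun X : 'M[R]_m => ((\rank X)%:R : R)%:E)).
  move=> I J /=.
  by rewrite -!EFinD lee_fin -!natrD ler_nat mxrank_submodular.
apply: (submodular_sum (F := fun X : 'M[R]_m => lne (\det X)%:E)) => I J.
cbv beta zeta.
(* If the intersection is empty, the left side is [-oo], except for [m = 0], where every determinant
   is 1. Otherwise some [M i] makes the sum over the intersection positive definite. *)
have [->|[i iIJ]] := set_0Vmem (I :&: J).
  rewrite big_set0; have [m0|m0] := posnP m.
    by subst m; rewrite !det_mx00 lne1 adde0.
  have -> : \det (0 : 'M[R]_m) = 0.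
    by rewrite -[0](scale0r 0) detZ expr0n gtn_eqF// mul0r.
  by rewrite [lne 0%:E]le0_lneNy// addeNy leNye.
apply: lne_det_submodular => //; rewrite (bigD1 i)//=.
apply: posdefmxD => //; apply: big_ind => //; first exact: possemidefmx0.
exact: possemidefmxD.
Qed.
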